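(* Let $K$ be a field with prime subring $k$ (the subring generated by $1$). Let $M_K$ denote the set of all pseudo-absolute values on $K$, equipped with its natural topology. Then $M_K$ is a non-empty, compact and Hausdorff topological space. Moreover, the specification map $j : M_K \to \mathrm{ZR}(K/k)$, sending a pseudo-absolute value $|\cdot|$ to its finiteness ring $\{a\in K : |a|<+\infty\}$, is continuous, where $\mathrm{ZR}(K/k)$ is equipped with the Zariski topology.
   Context: A pseudo-absolute value on a field $K$ is a map $|\cdot| : K\to[0,+\infty]$ such that (i) $|1|=1$ and $|0|=0$; (ii) $|a+b|\le |a|+|b|$ for all $a,b\in K$; (iii) $|ab|=|a||b|$ for all $a,b\in K$ with $\{|a|,|b|\}\neq\{0,+\infty\}$. For such $|\cdot|$, the set $\{a\in K:|a|<+\infty\}$ is a valuation ring of $K$ (i.e. with fraction field $K$), called the finiteness ring. The topology on $M_K$ is the coarsest one making all the maps $M_K\to[0,+\infty]$, $x\mapsto |f|_x$, continuous, for $f\in K$ (here $|\cdot|_x$ is the map corresponding to $x\in M_K$ and $[0,+\infty]$ has its usual topology). The Zariski-Riemann space $\mathrm{ZR}(K/k)$ is the set of valuation rings of $K$ (with fraction field $K$, the trivial one $K$ included) containing $k$. Its Zariski topology has as a basis the sets $E(B)=\{V\in\mathrm{ZR}(K/k): B\subset V\}$, where $B$ runs over the finitely generated $k$-subalgebras of $K$. *)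

(* Defs.v *)
From HB Require Import structures.
From mathcomp Require Import all_boot all_order all_algebra.
From mathcomp Require Import all_classical all_reals all_analysis.

Set Implicit Arguments.
Unset Strict Implicit.
Unset Printing Implicit Defensive.

Import Order.TTheory GRing.Theory Num.Theory.

Local Open Scope classical_set_scope.
Local Open Scope ring_scope.

Section Rings.
Variable K : fieldType.

Definition is_subring (V : set K) : Prop := subring_closed [in V].

Definition generated_subring (S : set K) : set K := smallest is_subring S.

Definition prime_subring : set K := generated_subring [set 1].

(* The last clause already forces the fraction field of V to be K, see
   valuation_ring_frac; V = K is allowed. *)
Definition is_valuation_ring (V : set K) : Prop :=
  is_subring V /\ (forall a : K, a != 0 -> V a \/ V a^-1).

Lemma is_subringP (V : set K) : is_subring V <->
  [/\ V 1, (forall a b, V a -> V b -> V (a - b))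
         & (forall a b, V a -> V b -> V (a * b))].
Proof.
split=> [[/set_mem V1 VB VM]|[V1 VB VM]]; split.
- exact: V1.
- by move=> a b Va Vb; apply/set_mem/VB; apply/mem_set.
- by move=> a b Va Vb; apply/set_mem/VM; apply/mem_set.
- exact/mem_set.
- by move=> a b /set_mem Va /set_mem Vb; apply/mem_set/VB.
- by move=> a b /set_mem Va /set_mem Vb; apply/mem_set/VM.
Qed.

Lemma valuation_ring_frac (V : set K) : is_valuation_ring V ->
  forall x, exists a b, [/\ V a, V b, b != 0 & x = a / b].
Proof.
move=> [/is_subringP[V1 VB _] VV] x.
have [->|x0] := eqVneq x 0.
  exists 0, 1; split; rewrite ?oner_neq0 ?mul0r //.
  by rewrite -(subrr 1); apply: VB.
have [Vx|Vx] := VV x x0.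
  by exists x, 1; split; rewrite ?oner_neq0 ?divr1.
by exists 1, x^-1; split; rewrite ?invr_eq0 // invrK mul1r.
Qed.

Definition fin_gen_subalgebra (k B : set K) : Prop :=
  exists s : seq K, B = generated_subring (k `|` [set` s]).

Record ZR (k : set K) := MkZR {
  ZR_set :> set K ;
  ZR_valuation_ring : is_valuation_ring ZR_set ;
  ZR_sub : k `<=` ZR_set }.

Definition ZR_E (k B : set K) : set (ZR k) := [set V : ZR k | B `<=` V].
Arguments ZR_E : clear implicits.

Lemma ZR_E_gen (k : set K) (s : seq K) :
  ZR_E k (generated_subring (k `|` [set` s])) = [set V : ZR k | [set` s] `<=` V].
Proof.
apply/seteqP; split=> V /=.
  move=> sV x sx; apply: sV; apply: sub_gen_smallest; by right.
move=> sV; apply: smallest_sub; first by case: (ZR_valuation_ring V).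
by rewrite subUset; split=> //; exact: ZR_sub.
Qed.

Lemma ZR_E_cover (k : set K) :
  \bigcup_(B in [set B | fin_gen_subalgebra k B]) ZR_E k B = setT.
Proof.
apply/seteqP; split=> // V _.
exists (generated_subring (k `|` [set` [::]])); first by exists [::].
by rewrite ZR_E_gen.
Qed.

Lemma ZR_E_join (k B1 B2 : set K) (V : ZR k) :
  fin_gen_subalgebra k B1 -> fin_gen_subalgebra k B2 ->
  ZR_E k B1 V -> ZR_E k B2 V ->
  exists B, [/\ fin_gen_subalgebra k B, ZR_E k B V
              & ZR_E k B `<=` ZR_E k B1 `&` ZR_E k B2].
Proof.
move=> [s ->] [t ->]; rewrite !ZR_E_gen /= => sV tV.
exists (generated_subring (k `|` [set` s ++ t])); split; first by exists (s ++ t).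
  by rewrite ZR_E_gen /= => x /=; rewrite mem_cat => /orP[/sV|/tV].
move=> W; rewrite ZR_E_gen /= => stW.
by split=> x xs; apply: stW; rewrite /= mem_cat xs ?orbT.
Qed.

End Rings.

Arguments prime_subring K : clear implicits.
Arguments ZR_E {K} k B.

Section ZariskiTopology.
Variables (K : fieldType) (k : set K).

HB.instance Definition _ := gen_eqMixin (ZR k).
HB.instance Definition _ := gen_choiceMixin (ZR k).
HB.instance Definition _ := @isBaseTopological.Build (ZR k)
  (set K) [set B | fin_gen_subalgebra k B] (ZR_E k)
  (ZR_E_cover k) (fun B1 B2 V => @ZR_E_join K k B1 B2 V).

End ZariskiTopology.

(* R is any model of the real numbers; [0, +oo] is seen inside \bar R. *)
Record pseudo_absval (R : realType) (K : fieldType) := PseudoAbsVal {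
  pabs :> K -> \bar R ;
  pabs_ge0 : forall a : K, (0 <= pabs a)%E ;
  pabs1 : pabs 1 = 1%E ;
  pabs0 : pabs 0 = 0%E ;
  pabsD : forall a b : K, (pabs (a + b)%R <= pabs a + pabs b)%E ;
  pabsM : forall a b : K, [set pabs a; pabs b] <> [set 0%E; +oo%E] ->
    pabs (a * b) = (pabs a * pabs b)%E }.

Section PseudoAbsValTopology.
Variables (R : realType) (K : fieldType).
Local Notation M := (pseudo_absval R K).

HB.instance Definition _ := gen_eqMixin M.
HB.instance Definition _ := gen_choiceMixin M.
(* The coarsest topology making all the maps x |-> |f|_x continuous; since
   they are nonnegative, it is the same to see them as valued in [0, +oo] or
   in \bar R. *)
HB.instance Definition _ := Topological.copy M
  (sup_topology (fun f : K =>
     Topological.class (initial_topology (fun x : M => x f)))).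

End PseudoAbsValTopology.

Section Specification.
Variables (R : realType) (K : fieldType).
Implicit Types x : pseudo_absval R K.

Definition finiteness_ring x : set K := [set a | (x a < +oo)%E].

Lemma pabsM_fin x a b : (x a < +oo)%E -> (x b < +oo)%E ->
  x (a * b) = (x a * x b)%E.
Proof.
move=> xa xb; apply: pabsM => /seteqP[_ /(_ +oo%E)] /=.
by case=> [|e|e]; [right|rewrite -e ltxx in xa|rewrite -e ltxx in xb].
Qed.

Lemma pabsM_pinfty x a b : x a = +oo%E -> x b = +oo%E -> x (a * b) = +oo%E.
Proof.
move=> xa xb; rewrite pabsM xa xb ?mulyy//.
by move=> /seteqP[_ /(_ 0%E)] /=; case=> //; left.
Qed.

Lemma pabsN1 x : (x (-1)%R < +oo)%E.
Proof.
rewrite ltey; apply/eqP => xy.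
by have := pabsM_pinfty xy xy; rewrite mulrNN mulr1 pabs1.
Qed.

Lemma finiteness_ring_subring x : is_subring (finiteness_ring x).
Proof.
have fM a b : finiteness_ring x a -> finiteness_ring x b ->
    finiteness_ring x (a * b).
  rewrite /finiteness_ring /= => xa xb; rewrite pabsM_fin//.
  rewrite -ge0_fin_numE ?mule_ge0 ?pabs_ge0//.
  by rewrite fin_numM// ge0_fin_numE ?pabs_ge0.
apply/is_subringP; split => //.
  by rewrite /finiteness_ring /= pabs1 ltry.
move=> a b xa xb; rewrite /finiteness_ring /=.
apply: le_lt_trans (pabsD _ _ _) _; apply: lte_add_pinfty => //.
by rewrite -mulN1r; apply: fM => //; exact: pabsN1.
Qed.

Lemma finiteness_ring_valuation_ring x :
  is_valuation_ring (finiteness_ring x).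
Proof.
split; first exact: finiteness_ring_subring.
move=> a a0; rewrite /finiteness_ring /= !ltey.
have [xa|] := eqVneq (x a) +oo%E; last by left.
right; apply/eqP => xV; have := pabsM_pinfty xa xV.
by rewrite divff// pabs1.
Qed.

Lemma prime_subring_sub_finiteness_ring x :
  prime_subring K `<=` finiteness_ring x.
Proof.
apply: smallest_sub; first exact: finiteness_ring_subring.
by move=> _ ->; rewrite /finiteness_ring /= pabs1 ltry.
Qed.

Definition specification x : ZR (prime_subring K) :=
  MkZR (finiteness_ring_valuation_ring x)
       (@prime_subring_sub_finiteness_ring x).

End Specification.

(* Main.v *)
Require Import Defs.
From mathcomp Require Import all_boot all_order all_algebra.
From mathcomp Require Import all_classical all_reals all_analysis.

(** The space of pseudo-absolute values carries the topology of pointwise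
    convergence, that is, the topology induced by its embedding in the product
    of copies of the extended real line indexed by K ([pabs_cvgP]). It is
    Hausdorff because the extended real line is ([pabs_hausdorff]), and it
    contains the trivial absolute value ([pabs_nonempty]).

    For compactness, take an ultrafilter of pseudo-absolute values. The
    extended real line is compact, so the ultrafilter has a limit at every
    element of K, and one has to see that these limits form a pseudo-absolute
    value ([pointwise_limit]). Only multiplicativity needs care, since the
    product of the extended real line is not continuous at (0, +oo). But that
    is the pair that the axiom leaves out, and the complement of
    {(0, +oo), (+oo, 0)} in [0, +oo]^2 is open: if the limits at a and b avoid
    it, then so do the values at a and b of nearby pseudo-absolute values, which
    are therefore multiplicative on (a, b) ([pabs_near_mul]).

    The specification map is continuous because the inverse image of the basic
    open set of the algebra generated by a finite set s consists of the x with
    |a|_x < +oo for all a in s ([finiteness_open]). *)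

Set Implicit Arguments.
Unset Strict Implicit.
Unset Printing Implicit Defensive.

Import Order.TTheory GRing.Theory Num.Theory.

Local Open Scope classical_set_scope.

(** Evaluation at a fixed element of K is not surjective, so the image filter
    has to be taken in the sense of inverse images, where no surjectivity is
    required. *)
Lemma ultra_fmap (T U : Type) (f : T -> U) (F : set_system T) :
  UltraFilter F -> UltraFilter (f @ F).
Proof.
move=> FU; split; first exact: fmap_proper_filter.
move=> G GF sFG; apply/seteqP; split=> // A GA.
have [//|FnA] := in_ultra_setVsetC (f @^-1` A) FU.
have /filter_ex[y []//] : G (A `&` ~` A).
by apply: filterI => //; exact: sFG.
Qed.

Section ExtendedReals.
Variable R : realType.
Local Open Scope ring_scope.

(** The distance on the extended reals is transported from [-1, 1] by
    [contract], so that its inverse [expand] is an isometry from the compact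
    segment [-1, 1] onto them. *)
Lemma ereal_compact : compact [set: \bar R].
Proof.
have -> : [set: \bar R] = @expand R @` [set` `[-1, 1]].
  apply/seteqP; split=> // x _; exists (contract x); last exact: contractK.
  by rewrite /= in_itv /= -ler_norml contract_le1.
apply: continuous_compact; last exact: segment_compact.
apply/subspace_continuousP => r r01.
apply/cvg_ballP => e e0.
near=> s.
have s01 : [set` `[-1, 1]] s by near: s; apply: withinT.
rewrite /ball /= /ereal_ball !expandK ?inE ?ler_norml//.
near: s.
by apply: cvg_within; exact: nbhsx_ballx.
Unshelve. all: by end_near. Qed.

Local Open Scope ereal_scope.

Lemma set2_0y (u v : \bar R) : [set u; v] = [set 0; +oo] <->
  (u = 0 /\ v = +oo) \/ (u = +oo /\ v = 0).
Proof.
split; last by case=> -[-> ->] //; rewrite setUC.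
move=> uv.
have [] : [set 0; +oo] u by rewrite -uv; left.
- have [<-|<-] : [set u; v] +oo by rewrite uv; right.
  + by [].
  + by left.
- have [<-|<-] : [set u; v] 0 by rewrite uv; left.
  + by [].
  + by right.
Qed.

End ExtendedReals.

Section PseudoAbsoluteValues.
Variables (R : realType) (K : fieldType).
Local Notation M := (pseudo_absval R K).
Implicit Types (x y : M) (a b : K) (F : set_system M).
Local Open Scope ereal_scope.

Lemma pabs_inj x y : x =1 y :> (K -> \bar R) -> x = y.
Proof.
case: x y => [f f1 f2 f3 f4 f5] [g g1 g2 g3 g4 g5] /= /funext fg.
rewrite fg in f1 f2 f3 f4 f5 *.
by f_equal; exact: Prop_irrelevance.
Qed.

Lemma pabs_cvgP F x : Filter F ->
  F --> x <-> forall a, (fun y : M => y a) @ F --> x a.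
Proof.
move=> FF; split.
  move=> /cvg_sup Fx a A Axa; apply: (Fx a ((fun y : M => y a) @^-1` A)).
  exact: (@initial_continuous M (\bar R) (fun y : M => y a) x A Axa).
move=> Fx; apply/cvg_sup => a A [_ [[B oB <-] Bxa] BA].
apply: filterS BA _; apply: (Fx a B).
exact: open_nbhs_nbhs.
Qed.

Lemma pabs_continuous a : continuous (fun x : M => x a).
Proof. by move=> x; have [xP _] := pabs_cvgP x (nbhs_filter x); exact: xP. Qed.

(** Points that cannot be separated have values that cannot be separated. *)
Lemma pabs_hausdorff : hausdorff_space M.
Proof.
move=> x y xy; apply: pabs_inj => a; apply: ereal_hausdorff => A B Ax By.
have [z [Az Bz]] := xy _ _ (pabs_continuous Ax) (pabs_continuous By).
by exists (z a).
Qed.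

(** A pair (u, v) in [0, +oo]^2 other than (0, +oo) and (+oo, 0) has both
    entries finite or both entries positive. Each of these is an open condition
    under which a pseudo-absolute value is multiplicative. *)
Lemma pabs_near_mul F a b (u v : \bar R) : Filter F ->
  0 <= u -> 0 <= v -> [set u; v] <> [set 0; +oo] ->
  (fun y : M => y a) @ F --> u -> (fun y : M => y b) @ F --> v ->
  \forall y \near F, (y : M) (a * b)%R = y a * y b.
Proof.
move=> FF u0 v0 uv au bv.
have [[uy vy]|[ugt0 vgt0]] : (u < +oo /\ v < +oo) \/ (0 < u /\ 0 < v).
- rewrite !ltey !lt0e u0 v0 !andbT.
  have [u0'|_] := eqVneq u 0; have [v0'|_] := eqVneq v 0.
  + by left; rewrite u0' v0'.
  + left; split; first by rewrite u0'.
    by apply/eqP => vy; apply/uv/set2_0y; left.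
  + left; split; last by rewrite v0'.
    by apply/eqP => uy; apply/uv/set2_0y; right.
  + by right.
- have ya : \forall y \near F, (y : M) a < +oo by exact: au (open_ereal_lt' uy).
  have yb : \forall y \near F, (y : M) b < +oo by exact: bv (open_ereal_lt' vy).
  by apply: filterS2 ya yb => y; exact: pabsM_fin.
- have ya : \forall y \near F, 0 < (y : M) a by exact: au (open_ereal_gt' ugt0).
  have yb : \forall y \near F, 0 < (y : M) b by exact: bv (open_ereal_gt' vgt0).
  apply: filterS2 ya yb => y ya yb; apply: pabsM => /set2_0y.
  by case=> -[ya0 yb0]; move: ya yb; rewrite /= ya0 yb0 ?ltxx.
Qed.

(** The pseudo-absolute values form a closed subset of the product: the axioms
    that are equalities or weak inequalities between continuous functions of the
    values pass to the limit, and the remaining one does by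
    [pabs_near_mul]. *)
Lemma pointwise_limit F (l : K -> \bar R) : ProperFilter F ->
  (forall a, (fun y : M => y a) @ F --> l a) -> exists x : M, x =1 l.
Proof.
move=> FF Fl.
have l_ge0 a : 0 <= l a.
  by apply: (cvge_to_ge (Fl a)); apply: nearW => y; exact: pabs_ge0.
have l_cst a c : (forall y, y a = c) -> l a = c.
  move=> ac; apply: (cvg_unique (@ereal_hausdorff R) (Fl a)).
  by apply: cvg_near_cst; apply: nearW.
have lD a b : l (a + b)%R <= l a + l b.
  have ab : (fun y : M => y a + y b) @ F --> l a + l b.
    by apply: cvgeD => //; apply: ge0_adde_def; rewrite inE.
  apply: lee_cvg_to (Fl (a + b)%R) ab _.
  by apply: nearW => y; exact: pabsD.
have lM a b : [set l a; l b] <> [set 0; +oo] -> l (a * b)%R = l a * l b.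
  move=> ab.
  apply: (cvg_unique (@ereal_hausdorff R) (Fl (a * b)%R)).
  have labM : l a *? l b.
    rewrite mule_defE !gee0_abs //; apply/negP => /orP[]/andP[/eqP a0 /eqP b0].
      by apply/ab/set2_0y; left.
    by apply/ab/set2_0y; right.
  apply: cvg_trans (cvgeM labM (Fl a) (Fl b)).
  apply: near_eq_cvg.
  by apply: filterS (pabs_near_mul _ _ _ ab (Fl a) (Fl b)) => // y /= ->.
have l1 := l_cst 1%R 1 (@pabs1 _ _); have l0 := l_cst 0%R 0 (@pabs0 _ _).
by exists (PseudoAbsVal l_ge0 l1 l0 lD lM).
Qed.

Lemma pabs_compact : compact [set: M].
Proof.
rewrite compact_ultra => F FU _.
have cF a : exists c : \bar R, (fun y : M => y a) @ F --> c.
  have := @ereal_compact R; rewrite compact_ultra.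
  move=> /(_ _ (ultra_fmap (fun y : M => y a) FU)) [|c [_ Fc]].
    exact: filterT.
  by exists c.
have [l Fl] := choice cF.
have [x xl] := pointwise_limit _ Fl.
by exists x; split=> //; apply/pabs_cvgP => a; rewrite xl; exact: Fl.
Qed.

Lemma pabs_nonempty : [set: M] !=set0.
Proof.
pose triv (a : K) : \bar R := (a != 0)%R%:R%:E.
suff x : M by exists x.
apply: (@PseudoAbsVal _ _ triv) => [a|||a b|a b _]; rewrite /triv.
- by rewrite lee_fin.
- by rewrite oner_neq0.
- by rewrite eqxx.
- rewrite -EFinD lee_fin -natrD ler_nat.
  have [->|_] /= := eqVneq a 0%R; first by rewrite add0r.
  by rewrite (leq_trans (leq_b1 _))// leq_addr.
- by rewrite -EFinM -natrM mulnb mulf_eq0 negb_or.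
Qed.

Lemma finiteness_open (s : seq K) :
  open [set x : M | [set` s] `<=` finiteness_ring x].
Proof.
rewrite (_ : mkset _ = \bigcap_(a in [set` s]) [set x : M | x a < +oo]);
  last by apply/seteqP; split=> x /= sx a /sx.
rewrite bigcap_seq; apply: big_ind; [exact: openT|exact: openI|] => a _.
by have /continuousP/(_ _ (@open_ereal_lt_ereal R +oo)) := @pabs_continuous a.
Qed.

Lemma specification_continuous : continuous (@specification R K).
Proof.
apply/continuousP => _ [D' sD' <-].
rewrite preimage_bigcup; apply: bigcup_open => B /sD' [s ->].
change (open (@specification R K @^-1` ZR_E (prime_subring K)
  (generated_subring (prime_subring K `|` [set` s])))).
by rewrite ZR_E_gen; exact: finiteness_open.
Qed.

End PseudoAbsoluteValues.

Theorem theorem1 (R : realType) (K : fieldType) :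
  [/\ [set: pseudo_absval R K] !=set0,
      compact [set: pseudo_absval R K],
      hausdorff_space (pseudo_absval R K)
    & continuous (@specification R K)].
Proof.
split; [exact: pabs_nonempty|exact: pabs_compact|exact: pabs_hausdorff|].
exact: specification_continuous.
Qed.
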